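(* Let $V$ be a finite-dimensional vector space over a field $\mathbb{K}$ and let $\mathcal{F}=\{\langle\cdot,\cdot\rangle_i\}_{i\in I}$ be a family of inner products on $V$. Then $\mathcal{F}$ is simultaneously orthogonalizable if and only if there is a finite set $J$ and subspaces $V_j\subseteq V$ ($j\in J$) such that $V=\mathrm{rad}(\mathcal{F})\oplus\bigoplus_{j\in J}V_j$, where the summands are pairwise orthogonal relative to every inner product of $\mathcal{F}$, and such that for each $j\in J$ the family $\mathcal{F}|_{V_j}$ is nondegenerate and simultaneously orthogonalizable.
   Context: An inner product on a $\mathbb{K}$-vector space $V$ means a symmetric bilinear form $V\times V\to\mathbb{K}$ (possibly degenerate). The index set $I$ is nonempty. The radical of an inner product is $\mathrm{rad}(\langle\cdot,\cdot\rangle)=\{x\in V:\langle x,y\rangle=0\ \forall y\in V\}$, and the radical of the family is $\mathrm{rad}(\mathcal{F})=\bigcap_{i\in I}\mathrm{rad}(\langle\cdot,\cdot\rangle_i)$. A family is nondegenerate if at least one of its members is nondegenerate (has zero radical). A family is simultaneously orthogonalizable if there is a single basis $\{v_j\}$ of the space such that $\langle v_j,v_k\rangle_i=0$ whenever $j\neq k$, for every $i\in I$ (isotropic basis vectors are allowed). For a subspace $S\subseteq V$, $\mathcal{F}|_S$ denotes the family of restrictions of the $\langle\cdot,\cdot\rangle_i$ to $S\times S$, $i\in I$. The set $J$ may be empty. *)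

(* Defs.v *)
From HB Require Import structures.
From mathcomp Require Import all_boot all_order all_algebra.
From mathcomp Require Import boolp.

Set Implicit Arguments.
Unset Strict Implicit.
Unset Printing Implicit Defensive.

Import GRing.Theory.
Local Open Scope ring_scope.

(* An inner product on V is an element of {symmetric V}, a symmetric bilinear
   form, possibly degenerate; its radical is [orthov f fullv]. *)

Lemma bigcapv_exists (K : fieldType) (V : vectType K) (I : Type)
    (U : I -> {vspace V}) :
  exists W : {vspace V}, forall x, x \in W <-> forall i, x \in U i.
Proof.
pose d (s : seq I) := \dim (\bigcap_(i <- s) U i)%VS.
have exd : exists n, `[< exists s, d s = n >].
  by exists (d [::]); apply/asboolP; exists [::].
case: (ex_minnP exd) => n /asboolP[s ds] minn_d.
exists (\bigcap_(i <- s) U i)%VS => x; split=> [xW i|xU].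
  suff /eqP Wi : (\bigcap_(j <- i :: s) U j == \bigcap_(j <- s) U j)%VS.
    by move: xW; rewrite -Wi big_cons memv_cap => /andP[].
  rewrite eqEdim {1}big_cons capvSr /= -/(d s) -/(d (i :: s)) ds.
  by apply: minn_d; apply/asboolP; exists (i :: s).
elim: s {ds} => [|i s IHs]; first by rewrite big_nil memvf.
by rewrite big_cons memv_cap xU.
Qed.

(* Intersection of an arbitrary, possibly infinite, family of subspaces. *)
Definition bigcapv (K : fieldType) (V : vectType K) (I : Type)
    (U : I -> {vspace V}) : {vspace V} :=
  projT1 (cid (bigcapv_exists U)).

Lemma mem_bigcapv (K : fieldType) (V : vectType K) (I : Type)
    (U : I -> {vspace V}) (x : V) :
  x \in bigcapv U <-> forall i, x \in U i.
Proof. exact: projT2 (cid (bigcapv_exists U)) x. Qed.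

Definition family_rad (K : fieldType) (V : vectType K) (I : Type)
    (F : I -> {symmetric V}) : {vspace V} :=
  bigcapv (fun i => orthov (F i) fullv).

Lemma mem_family_rad (K : fieldType) (V : vectType K) (I : Type)
    (F : I -> {symmetric V}) (x : V) :
  x \in family_rad F <-> forall i y, F i x y = 0.
Proof.
split=> [/mem_bigcapv xF i y|xF]; first exact/(mem_orthovP (xF i))/memvf.
by apply/mem_bigcapv => i; apply/mem_orthovP => y _; apply: xF.
Qed.

Definition family_nondegenerate (K : fieldType) (V : vectType K) (I : Type)
    (F : I -> {symmetric V}) : Prop :=
  exists i, nondegenerate (F i).

Definition simultaneously_orthogonalizable (K : fieldType) (V : vectType K)
    (I : Type) (F : I -> {symmetric V}) : Prop :=
  exists v : (\dim {:V}).-tuple V, basis_of fullv v /\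
    forall i j k, j != k -> F i (tnth v j) (tnth v k) = 0.

Section Restriction.

Context (K : fieldType) (V : vectType K) (f : {symmetric V}) (S : {vspace V}).

Definition restr_form (u v : subvs_of S) : K := f (vsval u) (vsval v).

Fact restr_form_bilinear : bilinear_for *%R (idfun \; *%R) restr_form.
Proof.
by split=> [w|w] a u v; rewrite /restr_form linearP /= ?linearPl ?linearPr.
Qed.

HB.instance Definition _ :=
  bilinear_isBilinear.Build K (subvs_of S) (subvs_of S) K *%R (idfun \; *%R)
    restr_form restr_form_bilinear.

Fact restr_form_symmetric u v :
  restr_form u v = (-1) ^+ false * idfun (restr_form v u).
Proof. exact: hermitian_subproof. Qed.

HB.instance Definition _ :=
  isHermitianSesquilinear.Build K (subvs_of S) false idfun restr_form
    restr_form_symmetric.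

End Restriction.

Definition family_restr (K : fieldType) (V : vectType K) (I : Type)
    (F : I -> {symmetric V}) (S : {vspace V}) : I -> {symmetric (subvs_of S)} :=
  fun i => restr_form (F i) (S := S).

(* Main.v *)
Require Import Defs.
From mathcomp Require Import all_boot all_order all_algebra.
From mathcomp Require Import boolp.

Set Implicit Arguments.
Unset Strict Implicit.
Unset Printing Implicit Defensive.

Import GRing.Theory.
Local Open Scope ring_scope.

(* Given an orthogonal basis, the vectors isotropic for every form span the
   radical and each remaining vector spans a one-dimensional nondegenerate
   summand.  Conversely, a basis of the radical together with orthogonal bases
   of the summands is an orthogonal basis of the whole space. *)

Lemma symmetric_formC (K : fieldType) (V : vectType K) (f : {symmetric V}) u v :
  f u v = f v u.
Proof. by rewrite [LHS]hermitian_subproof /= expr0 mul1r. Qed.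

(** Vectors of [subvs_of S] are traded for vectors of [V] lying in [S], so that later arguments stay
    inside [V]. *)
Lemma nondegenerate_restrP (K : fieldType) (V : vectType K)
    (f : {symmetric V}) (S : {vspace V}) :
  reflect {in S, forall u, {in S, forall y, f u y = 0} -> u = 0}
          (nondegenerate (restr_form f (S := S))).
Proof.
apply: (iffP eqP) => [f_nd u Su fu0|f_nd].
  suff: vsproj S u \in orthov (restr_form f (S := S)) fullv.
    by rewrite f_nd memv0 => /eqP/(congr1 vsval); rewrite vsprojK.
  apply/mem_orthovP => y _; rewrite /= /restr_form vsprojK //.
  exact/fu0/subvsP.
apply/eqP; rewrite -subv0; apply/subvP => u /mem_orthovP fu0.
rewrite memv0; apply/eqP/subvs_inj; rewrite linear0.
apply: f_nd (subvsP u) _ => y Sy.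
by rewrite -(fu0 _ (memvf (vsproj S y))) /= /restr_form vsprojK.
Qed.

(** For each [j], some form of the family is nondegenerate on [W j]. Pairing a sum of components
    with a vector of [W j] under that form leaves only the [j]-th term, so a sum lying in the
    radical has every component zero. *)
Lemma directv_family_rad (K : fieldType) (V : vectType K) (I : Type)
    (F : I -> {symmetric V}) (J : finType) (W : J -> {vspace V}) :
    (forall i j k, j != k -> (W j <= orthov (F i) (W k))%VS) ->
    (forall j, family_nondegenerate (family_restr F (W j))) ->
  directv (family_rad F + \sum_(j : J) W j)%VS.
Proof.
move=> W_orth W_nd.
have component_eq0 us : (forall j, us j \in W j) ->
    \sum_j us j \in family_rad F -> forall j, us j = 0.
  move=> usW /mem_family_rad us_rad j.
  have [i /nondegenerate_restrP] := W_nd j; apply=> // y yW.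
  rewrite -(us_rad i y) linear_sumlz (bigD1 j) //= big1 ?addr0 // => k kj.
  exact: mem_orthovP (subvP (W_orth i _ _ kj) _ (usW k)) _ yW.
(* Both remaining claims are instances of [component_eq0]: a zero sum lies in the radical, and so
   does a vector common to the radical and the sum of the [W j]. *)
rewrite directv_addE directv_trivial /=; apply/andP; split.
  apply/directv_sum_independent => us usW us0 j _.
  apply: component_eq0 => [k|]; first exact: usW.
  by rewrite us0 mem0v.
rewrite -subv0; apply/subvP => x /memv_capP[xrad /memv_sumP[us usW defx]].
rewrite memv0 defx big1 // => j _; apply: component_eq0 => [k|].
  exact: usW.
by rewrite -defx.
Qed.

(** Sequences can be mapped and concatenated without tracking a length. Comparing vectors instead of
    indices loses nothing, because a basis has no repetitions. *)
Lemma orthogonalizable_seqP (K : fieldType) (V : vectType K) (I : Type)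
    (F : I -> {symmetric V}) :
  simultaneously_orthogonalizable F <->
  exists X : seq V, basis_of fullv X /\
    {in X &, forall u v, u != v -> forall i, F i u v = 0}.
Proof.
split=> [[v [v_basis v_orth]]|[X [X_basis X_orth]]].
  exists v; split=> // _ _ /tnthP[j ->] /tnthP[k ->] jk i.
  by apply: v_orth; apply: contraNneq jk => ->.
have sX : size X == \dim {:V}.
  by case/andP: X_basis => /eqP <- /eqnP ->.
exists (Tuple sX); split=> // i j k jk.
apply: X_orth; rewrite ?mem_tnth // !(tnth_nth 0) /=.
by rewrite nth_uniq ?(eqP sX) // (free_uniq (basis_free X_basis)).
Qed.

Lemma orthogonalizable_restr_basis (K : fieldType) (V : vectType K) (I : Type)
    (F : I -> {symmetric V}) (S : {vspace V}) :
    simultaneously_orthogonalizable (family_restr F S) ->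
  exists X : seq V, basis_of S X /\
    {in X &, forall u v, u != v -> forall i, F i u v = 0}.
Proof.
case/orthogonalizable_seqP=> Y [Y_basis Y_orth].
exists (map vsval Y); split; last first.
  by move=> _ _ /mapP[u Yu ->] /mapP[w Yw ->] uw; apply: Y_orth.
(* The inclusion is an injective linear map with image [S], hence sends a basis of [subvs_of S] to a
   basis of [S]. *)
have vsval_inj : lker (linfun (vsval : subvs_of S -> V)) == 0%VS.
  by apply/lker0P => u w; rewrite !lfunE; apply: subvs_inj.
have -> : map vsval Y = map (linfun (vsval : subvs_of S -> V)) Y.
  by apply: eq_map => u; rewrite lfunE.
have defS : S = (linfun (vsval : subvs_of S -> V) @: fullv)%VS.
  apply/vspaceP => x; apply/idP/memv_imgP => [xS|[u _ ->]].
    by exists (vsproj S x); rewrite ?memvf // lfunE /= vsprojK.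
  by rewrite lfunE subvsP.
by rewrite {1}defS; apply: limg_basis_of => //; rewrite (eqP vsval_inj) capv0.
Qed.

Lemma orthogonalizable_dim_le1 (K : fieldType) (V : vectType K) (I : Type)
    (F : I -> {symmetric V}) :
  (\dim {:V} <= 1)%N -> simultaneously_orthogonalizable F.
Proof.
move=> dimV; exists (vbasis fullv); split=> [|i j k]; first exact: vbasisP.
suff -> : j = k by rewrite eqxx.
apply/val_inj; move: (leq_trans (ltn_ord j) dimV) (leq_trans (ltn_ord k) dimV).
by rewrite !ltnS !leqn0 => /eqP vj0 /eqP vk0; rewrite /= vj0 vk0.
Qed.

Lemma isotropic_family_rad (K : fieldType) (V : vectType K) (I : Type)
    (F : I -> {symmetric V}) (X : seq V) (u : V) :
    basis_of fullv X ->
    {in X, forall v i, F i u v = 0} ->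
  u \in family_rad F.
Proof.
move=> X_basis u_orth; apply/mem_family_rad => i y.
rewrite (coord_basis (X := in_tuple X) X_basis (memvf y)) linear_sumr big1 //=.
by move=> j _; rewrite linearZr_LR /= u_orth ?mulr0 // mem_nth.
Qed.

Theorem theorem4 (K : fieldType) (V : vectType K) (I : Type)
    (I_nonempty : inhabited I) (F : I -> {symmetric V}) :
  simultaneously_orthogonalizable F <->
  exists (J : finType) (W : J -> {vspace V}),
    [/\ (family_rad F + \sum_(j : J) W j)%VS = fullv,
        directv (family_rad F + \sum_(j : J) W j)%VS,
        forall i j, (family_rad F <= orthov (F i) (W j))%VS,
        forall i j k, j != k -> (W j <= orthov (F i) (W k))%VS
      & forall j, family_nondegenerate (family_restr F (W j)) /\
                  simultaneously_orthogonalizable (family_restr F (W j))].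
Proof.
split=> [[v [v_basis v_orth]]|[J [W [W_full W_direct _ W_orth W_restr]]]].
  (* The form witnessing membership of [j] in [J] may depend on [j]; it is the one that is
     nondegenerate on the line [W j]. *)
  pose J := {j | `[< exists i, F i (tnth v j) (tnth v j) != 0 >]}.
  pose W (j : J) := <[tnth v (val j)]>%VS.
  have W_orth i j k : j != k -> (W j <= orthov (F i) (W k))%VS.
    move=> jk; rewrite -memvE; apply/mem_orthovP => _ /vlineP[a ->].
    by rewrite linearZr_LR /= v_orth ?mulr0.
  have W_nd j : family_nondegenerate (family_restr F (W j)).
    have /asboolP[i vj_aniso] := valP j; exists i.
    apply/nondegenerate_restrP => _ /vlineP[a ->] /(_ _ (memv_line _)).
    rewrite linearZl_LR /= => /eqP; rewrite mulf_eq0 (negPf vj_aniso) orbF.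
    by move/eqP->; rewrite scale0r.
  exists J, W; split=> //.
  - apply/eqP; rewrite eqEsubv subvf /=.
    apply: (@subv_trans _ _ <<v>>%VS); first by rewrite (span_basis v_basis).
    apply/span_subvP => _ /tnthP[j ->].
    have [vj_aniso|/asboolPn vj_iso] :=
      boolP `[< exists i, F i (tnth v j) (tnth v j) != 0 >].
      apply: subvP (addvSr _ _) _ _; rewrite memvE.
      exact: (sumv_sup (Sub j vj_aniso)).
    (* Outside [J], the vector is orthogonal to itself as well as to the other basis vectors, for
       every form. *)
    apply: subvP (addvSl _ _) _ _; apply: isotropic_family_rad v_basis _.
    move=> _ /tnthP[k ->] i; have [<-|jk] := eqVneq j k; last exact: v_orth.
    by apply: contra_notP vj_iso => /eqP; exists i.
  - exact: directv_family_rad.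
  - by move=> i j; apply/subvP => x /mem_family_rad xrad; apply/mem_orthovP.
  - move=> j; split=> //; apply: orthogonalizable_dim_le1.
    by rewrite dimvf /= /dim /= dim_vline leq_b1.
have /choice[X X_basis] j := orthogonalizable_restr_basis (W_restr j).2.
apply/orthogonalizable_seqP.
(* Any basis of the radical will do, since its vectors are orthogonal to everything. *)
exists (vbasis (family_rad F) ++ \big[cat/[::]]_j X j); split.
  move: W_direct; rewrite -W_full directv_addE.
  case/and3P=> _ sumW_direct /eqP/directv_addP rad_sumW.
  apply: cat_basis => //; first exact: vbasisP.
  by apply: bigcat_basis => // j _; case: (X_basis j).
have bigcatP u : u \in \big[cat/[::]]_j X j -> exists j, u \in X j.
  elim/big_rec: _ => // j s _ IHs.
  by rewrite mem_cat => /orP[uX|/IHs//]; exists j.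
move=> u w; rewrite !mem_cat => /orP[/vbasis_mem/mem_family_rad u_rad *|uX].
  exact: u_rad.
case/orP=> [/vbasis_mem/mem_family_rad w_rad *|].
  by rewrite symmetric_formC w_rad.
have [j uXj] := bigcatP u uX; case/bigcatP=> k wXk uw i.
have [[Xj_basis Xj_orth] [Xk_basis _]] := (X_basis j, X_basis k).
(* Within one block the chosen basis is orthogonal; across two blocks the summands themselves
   are. *)
have [jk|jk] := eqVneq j k; first by apply: Xj_orth; rewrite // jk.
exact: mem_orthovP (subvP (W_orth i _ _ jk) _ (basis_mem Xj_basis uXj)) _
  (basis_mem Xk_basis wXk).
Qed.
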